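(* Let $R$ be a ring, $M$ an $R$-module, $\phi:S(M)\to S(M)\cup\{\emptyset\}$ a function and $N$ a proper submodule of $M$. The following conditions are equivalent: (1) $N$ is a $\phi$-classical prime submodule of $M$; (2) for every $a,b\in R$, $(N:_M ab)=(\phi(N):_M ab)\cup(N:_M a)\cup(N:_M b)$; (3) for every $a\in R$ and $m\in M$ with $am\notin N$, $(N:_R am)=(\phi(N):_R am)\cup(N:_R m)$; (4) for every $a\in R$ and $m\in M$ with $am\notin N$, $(N:_R am)=(\phi(N):_R am)$ or $(N:_R am)=(N:_R m)$; (5) for every $a\in R$, every ideal $I$ of $R$ and every $m\in M$ with $aIm\subseteq N$ and $aIm\nsubseteq\phi(N)$, either $am\in N$ or $Im\subseteq N$; (6) for every ideal $I$ of $R$ and $m\in M$ with $Im\nsubseteq N$, $(N:_R Im)=(\phi(N):_R Im)$ or $(N:_R Im)=(N:_R m)$; (7) for all ideals $I,J$ of $R$ and every $m\in M$ with $IJm\subseteq N$ and $IJm\nsubseteq\phi(N)$, either $Im\subseteq N$ or $Jm\subseteq N$.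
   Context: All rings are commutative with nonzero identity and all modules are unitary. $S(M)$ is the set of all submodules of $M$. Standing convention: $\phi(N)\subseteq N$ for every $N\in S(M)$. A proper submodule $N$ of $M$ is $\phi$-classical prime if whenever $a,b\in R$ and $m\in M$ with $abm\in N\setminus\phi(N)$, then $am\in N$ or $bm\in N$. For $X$ a submodule of $M$ or $X=\emptyset$: $(X:_M a)=\{m\in M\mid am\in X\}$ for $a\in R$; $(X:_R m)=\{r\in R\mid rm\in X\}$ for $m\in M$; $(X:_R L)=\{r\in R\mid rL\subseteq X\}$ for a submodule $L$ of $M$ (so these sets are empty when $X=\emptyset$). *)

(* Defs.v *)
From HB Require Import structures.
From mathcomp Require Import all_boot all_order all_algebra.
From mathcomp Require Import boolp classical_sets.

Set Implicit Arguments.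
Unset Strict Implicit.
Unset Printing Implicit Defensive.

Import GRing.Theory.
Local Open Scope classical_set_scope.
Local Open Scope ring_scope.

(* Boolean predicates lose no generality here: with the classical axioms of
   boolp every Prop-valued subset is one.  MathComp's [idealr] is not used for
   ideals because it only contains the proper ones. *)
Notation submodule M := (submodClosed M).
Notation ideal R := (submodClosed R^o).

(* An element of S(M) \cup {emptyset}: [None] stands for the empty set, which
   is distinct from every submodule. *)
Definition carrier_or_empty (R : comNzRingType) (M : lmodType R)
  (X : option (submodule M)) : set M :=
  if X is Some L then [set` L] else set0.

Section Colon.
Variables (R : comNzRingType) (M : lmodType R).
Implicit Types (X L : set M) (a b r : R) (m : M).

(* (X :_M a) *)
Definition colonM X a : set M := [set m | X (a *: m)].

(* (X :_R m) *)
Definition colonR X m : set R := [set r | X (r *: m)].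

(* (X :_R L) *)
Definition colonRset X L : set R := [set r | [set r *: x | x in L] `<=` X].

End Colon.

Definition ideal_set (R : comNzRingType) (I : ideal R) : set R :=
  [set r : R | r \in I].

Definition ideal_mul (R : comNzRingType) (I J : ideal R) : set R :=
  [set x | exists (n : nat) (a b : 'I_n -> R),
     (forall i, a i \in I /\ b i \in J) /\ x = \sum_(i < n) a i * b i].

(* A m = {r m | r in A}; a submodule of M when A is an ideal. *)
Definition smul_elt (R : comNzRingType) (M : lmodType R) (A : set R) (m : M) :
  set M := [set r *: m | r in A].

Definition proper_submodule (R : comNzRingType) (M : lmodType R)
  (N : submodule M) : Prop :=
  [set` N] <> [set: M].

Definition phi_classical_prime (R : comNzRingType) (M : lmodType R)
  (phi : submodule M -> option (submodule M)) (N : submodule M) : Prop :=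
  proper_submodule N /\
  forall (a b : R) (m : M),
    ([set` N] `\` carrier_or_empty (phi N)) ((a * b) *: m) ->
    a *: m \in N \/ b *: m \in N.

(* Main.v *)
(* The implications are proved cyclically. In (3) => (4) and (5) => (6) the
   residual of N is a union of two sets closed under subtraction (the one coming
   from phi(N) may be empty), and an additive group is such a union only if it
   equals one of the two parts. (7) => (1) applies (7) to the principal ideals
   Ra and Rb. *)
Require Import Defs.
From HB Require Import structures.
From mathcomp Require Import all_boot all_order all_algebra.
From mathcomp Require Import boolp classical_sets.

Set Implicit Arguments.
Unset Strict Implicit.
Unset Printing Implicit Defensive.

Import GRing.Theory.
Local Open Scope classical_set_scope.
Local Open Scope ring_scope.

(** If neither part contains the other, take [x] in [B] outside [C] and [y] in [C] outside [B]:
    whichever part contains [x + y], subtracting the summand already there puts the other summand in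
    it too. Closure is phrased by differences, without asking for 0, so that an empty part is
    allowed. *)
Lemma addr_closed_setU_or (V : zmodType) (A B C : set V) :
  (forall x y, A x -> A y -> A (x + y)) ->
  (forall x y, B x -> B y -> B (x - y)) ->
  (forall x y, C x -> C y -> C (x - y)) ->
  A = B `|` C -> A = B \/ A = C.
Proof.
move=> addA subB subC defA.
have [CB|/existsNP[y /not_implyP[Cy nBy]]] := pselect (C `<=` B).
  by left; rewrite defA; apply/setUidPl.
have [BC|/existsNP[x /not_implyP[Bx nCx]]] := pselect (B `<=` C).
  by right; rewrite defA; apply/setUidPr.
have : A (x + y) by apply: addA; rewrite defA; [left|right].
rewrite defA => -[Bxy|Cxy].
- by case: nBy; rewrite -[y](addKr x) addrC; apply: subB.
- by case: nCx; rewrite -[x](addrK y); apply: subC.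
Qed.

Section Carrier.
Variables (R : comNzRingType) (M : lmodType R) (X : option (submodule M)).
Implicit Types (m x y : M) (L : set M).

Lemma carrier_or_emptyB x y :
  carrier_or_empty X x -> carrier_or_empty X y -> carrier_or_empty X (x - y).
Proof. by case: X => //= L Lx Ly; rewrite -scaleN1r rpredD ?rpredZ. Qed.

Lemma carrier_or_emptyZ (r : R) x :
  carrier_or_empty X x -> carrier_or_empty X (r *: x).
Proof. by case: X => //= L Lx; rewrite rpredZ. Qed.

(** The element [x] certifies that [X] is not [None]; for [None] the empty sum 0 would be a
    counterexample. *)
Lemma carrier_or_empty_sum x (n : nat) (f : 'I_n -> M) :
  carrier_or_empty X x -> (forall i, carrier_or_empty X (f i)) ->
  carrier_or_empty X (\sum_i f i).
Proof. by case: X => //= L _ Lf; apply: rpred_sum => i _; apply: Lf. Qed.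

Lemma colonR_carrierB m (r s : R) :
  colonR (carrier_or_empty X) m r -> colonR (carrier_or_empty X) m s ->
  colonR (carrier_or_empty X) m (r - s).
Proof. by rewrite /colonR /= scalerBl; apply: carrier_or_emptyB. Qed.

Lemma colonRset_carrierB L (r s : R) :
  colonRset (carrier_or_empty X) L r -> colonRset (carrier_or_empty X) L s ->
  colonRset (carrier_or_empty X) L (r - s).
Proof.
move=> Lr Ls _ [x Lx <-]; rewrite scalerBl.
by apply: carrier_or_emptyB; [apply: Lr|apply: Ls]; exists x.
Qed.

End Carrier.

Definition principal (R : comNzRingType) (a : R) : {pred R^o} :=
  fun r => `[< exists s : R, r = s * a >].

Lemma principalP (R : comNzRingType) (a r : R) :
  reflect (exists s, r = s * a) (r \in principal a).
Proof. exact: asboolP. Qed.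

Lemma principal_submod_closed (R : comNzRingType) (a : R) :
  submod_closed (principal a).
Proof.
split; first by apply/principalP; exists 0; rewrite mul0r.
move=> c u v /principalP[s ->] /principalP[t ->]; apply/principalP.
by exists (c * s + t); rewrite mulrDl -mulrA.
Qed.

HB.instance Definition _ (R : comNzRingType) (a : R) :=
  GRing.isSubmodClosed.Build R R^o (principal a) (principal_submod_closed a).

Lemma mem_principal (R : comNzRingType) (a : R) : a \in principal a.
Proof. by apply/principalP; exists 1; rewrite mul1r. Qed.

Theorem theorem2p11 (R : comNzRingType) (M : lmodType R)
  (phi : submodule M -> option (submodule M))
  (hphi : forall L : submodule M, carrier_or_empty (phi L) `<=` [set` L])
  (N : submodule M) (hN : proper_submodule N) :
  let N0 : set M := [set` N] in
  let phiN : set M := carrier_or_empty (phi N) in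
  [<->
    phi_classical_prime phi N;

    forall a b : R,
      colonM N0 (a * b) = colonM phiN (a * b) `|` colonM N0 a `|` colonM N0 b;

    forall (a : R) (m : M), ~ N0 (a *: m) ->
      colonR N0 (a *: m) = colonR phiN (a *: m) `|` colonR N0 m;

    forall (a : R) (m : M), ~ N0 (a *: m) ->
      colonR N0 (a *: m) = colonR phiN (a *: m) \/
      colonR N0 (a *: m) = colonR N0 m;

    forall (a : R) (I : ideal R) (m : M),
      [set a *: x | x in smul_elt (ideal_set I) m] `<=` N0 ->
      ~ ([set a *: x | x in smul_elt (ideal_set I) m] `<=` phiN) ->
      N0 (a *: m) \/ smul_elt (ideal_set I) m `<=` N0;

    forall (I : ideal R) (m : M), ~ (smul_elt (ideal_set I) m `<=` N0) ->
      colonRset N0 (smul_elt (ideal_set I) m) =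
        colonRset phiN (smul_elt (ideal_set I) m) \/
      colonRset N0 (smul_elt (ideal_set I) m) = colonR N0 m;

    forall (I J : ideal R) (m : M),
      smul_elt (ideal_mul I J) m `<=` N0 ->
      ~ (smul_elt (ideal_mul I J) m `<=` phiN) ->
      smul_elt (ideal_set I) m `<=` N0 \/ smul_elt (ideal_set J) m `<=` N0].
Proof.
move=> N0 phiN; have phiN_N : phiN `<=` N0 by apply: hphi.
(* The carrier of [Some N] is [N0] by computation, so the lemmas made for [phiN] also serve [N0]. *)
have NZ := @carrier_or_emptyZ _ _ (Some N).
tfae.
- move=> [_ prN] a b; apply/seteqP; split=> m /=.
    move=> Nabm; have [pabm|npabm] := pselect (phiN ((a * b) *: m)).
      by left; left.
    by case: (prN a b m (conj Nabm npabm)) => ?; [left; right|right].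
  move=> [[/phiN_N //|Nam]|Nbm]; rewrite /colonM /=.
    by rewrite mulrC -scalerA; apply: NZ.
  by rewrite -scalerA; apply: NZ.
- move=> eqN a m nNam; apply/seteqP; split=> r /=; rewrite /colonR /=.
    (* Membership of [r] in the residual of [a *: m] is read as membership of [m] in that of
       [r * a]; the part coming from [a] is excluded by [nNam]. *)
    move=> Nram; have : colonM N0 (r * a) m by rewrite /colonM /= -scalerA.
    by rewrite eqN /colonM /= -scalerA => -[[]|]; [left|right|].
  move=> [/phiN_N //|Nrm].
  by rewrite scalerA mulrC -scalerA; apply: NZ.
- move=> eqN a m nNam; apply: addr_closed_setU_or (eqN a m nNam).
  + by move=> x y; rewrite /colonR /= scalerDl; apply: rpredD.
  + exact: colonR_carrierB.
  + exact: (@colonR_carrierB _ _ (Some N)).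
- move=> eqN a I m aImN naIm; have [|nNam] := pselect (N0 (a *: m)); first by left.
  right=> _ [r Ir <-].
  (* All of [I] lies in the residual of [a *: m], hence in one of the two sets offered by (4): the
     first contradicts [naIm], the second gives the claim. *)
  have subI s : ideal_set I s -> colonR N0 (a *: m) s.
    move=> Is; rewrite /colonR /= scalerA mulrC -scalerA.
    by apply: aImN; exists (s *: m) => //; exists s.
  have [eqp|eqm] := eqN a m nNam; last first.
    by have := subI r Ir; rewrite eqm.
  case: naIm => _ [_ [s Is <-] <-].
  by have := subI s Is; rewrite eqp /colonR /= !scalerA mulrC.
- move=> prN I m nImN; apply: addr_closed_setU_or.
  + move=> x y Nx Ny _ [z Lz <-]; rewrite scalerDl.
    by apply: rpredD; [apply: Nx|apply: Ny]; exists z.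
  + exact: colonRset_carrierB.
  + exact: (@colonR_carrierB _ _ (Some N)).
  apply/seteqP; split=> r.
    (* Apply (5) with [r] in the role of [a]; its second alternative is ruled out by [nImN]. *)
    move=> Nr; have [|npr] := pselect (colonRset phiN (smul_elt (ideal_set I) m) r).
      by left.
    by right; case: (prN r I m Nr npr).
  move=> [pr x rx|Nrm _ [_ [s Is <-] <-]]; first exact/phiN_N/pr.
  by rewrite scalerA mulrC -scalerA; apply: NZ.
- move=> eqN I J m IJN nIJ.
  have [|nJN] := pselect (smul_elt (ideal_set J) m `<=` N0); first by right.
  left=> _ [r Ir <-].
  (* Here (6) is used for [J], with [I] inside the residual of [Jm]; a product [s * t] is an element
     of [IJ] as a sum of length one. *)
  have subI s : ideal_set I s -> colonRset N0 (smul_elt (ideal_set J) m) s.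
    move=> Is _ [_ [t Jt <-] <-]; rewrite scalerA; apply: IJN.
    exists (s * t) => //; exists 1, (fun=> s), (fun=> t).
    by rewrite big_ord1.
  have [eqp|eqm] := eqN J m nJN; last first.
    by have := subI r Ir; rewrite eqm.
  have prod_phi s t : s \in I -> t \in J -> phiN ((s * t) *: m).
    move=> Is Jt; have := subI s Is; rewrite eqp; apply.
    by exists (t *: m); [exists t|rewrite scalerA].
  case: nIJ => _ [_ [n [a [b [abIJ ->]]]] <-]; rewrite scaler_suml.
  (* [n] may be 0: that [phiN] is nonempty is witnessed by [0 * 0]. *)
  apply: (carrier_or_empty_sum (prod_phi 0 0 (rpred0 I) (rpred0 J))) => i.
  by have [? ?] := abIJ i; apply: prod_phi.
- move=> prN; split=> // a b m [Nabm npabm].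
  have [||aN|bN] := prN (principal a) (principal b) m.
  (* Each term [u i * v i] is a multiple of [a * b]. *)
  + move=> _ [_ [n [u [v [uv ->]]]] <-]; rewrite scaler_suml.
    apply: rpred_sum => i _; have [/principalP[s ->] /principalP[t ->]] := uv i.
    by rewrite mulrACA -scalerA; apply: NZ.
  (* The element [(a * b) *: m] itself witnesses that the product is not contained in [phiN]. *)
  + apply: contra_not npabm; apply; exists (a * b) => //.
    exists 1, (fun=> a), (fun=> b); rewrite big_ord1.
    by split=> // _; rewrite !mem_principal.
  + by left; apply: aN; exists a => //; apply: mem_principal.
  + by right; apply: bN; exists b => //; apply: mem_principal.
Qed.
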